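(* Let $k\ge1$ and let $\mathsf q=(q_1,\dots,q_k)$ be linearly independent elements of $\operatorname{im} d^*$ (that is, functions $q_i:V\to\mathbb K$ with $\sum_{v\in V}q_i(v)=0$). The random spanning forest which assigns to any $F\in\mathcal F_k(G)$ a probability proportional to $$\big|\det\big(q_i(V(T_j))\big)_{1\le i,j\le k}\big|^2\,\underline x^F$$ is determinantal, associated with the subspace $$H_{\mathsf q}=\{df:f\in\Omega^0(G),\ \langle q_i,f\rangle=0\text{ for all }i\in\{1,\dots,k\}\}$$ of $\Omega^1(G)$ and the orthonormal basis $(e^\star/\sqrt{x_e})_{e\in E^+}$ of $\Omega^1(G)$.
   Context: Let $\mathbb K=\mathbb R$ or $\mathbb C$. $G=(V,E)$ is a finite connected graph: $V$ is a finite set of vertices and $E$ a finite set of oriented edges, with source and target maps $s,t:E\to V$ and a fixed-point-free involution $e\mapsto e^{-1}$ of $E$ exchanging source and target. $E^+\subset E$ is a fixed subset containing exactly one element of each pair $\{e,e^{-1}\}$. Positive weights $\underline x=(x_e)_{e\in E}$ with $x_{e^{-1}}=x_e$ are given, and $\underline x^A=\prod_{e\in (A\cup A^{-1})\cap E^+}x_e$ for $A\subseteq E$. A subgraph is a subset $S\subseteq E$ stable under $e\mapsto e^{-1}$, seen as the graph $(V,S)$ and identified with $S\cap E^+$. $\mathcal F_k(G)$ is the set of acyclic (spanning) subgraphs with $k+1$ connected components (trees). For $F\in\mathcal F_k(G)$, $T_1,\dots,T_k$ is an enumeration of all the trees of $F$ except one, $V(T_j)$ is the vertex set of $T_j$,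 and $q_i(V(T_j))=\sum_{v\in V(T_j)}q_i(v)$; the squared modulus of the determinant does not depend on the enumeration nor on the omitted tree. $\Omega^0(G)$ is the space of functions $V\to\mathbb K$ with $\langle f,g\rangle=\sum_v\overline{f(v)}g(v)$; $\Omega^1(G)$ is the space of functions $\alpha:E\to\mathbb K$ with $\alpha(e^{-1})=-\alpha(e)$, with $\langle\alpha,\beta\rangle=\sum_{e\in E^+}x_e\overline{\alpha(e)}\beta(e)$; $e^\star\in\Omega^1(G)$, $e\in E^+$, is the form equal to $1$ on $e$, $-1$ on $e^{-1}$ and $0$ elsewhere. $df(e)=f(t(e))-f(s(e))$, and $d^*$ is the adjoint of $d$. Given a finite-dimensional inner product space with an orthonormal basis indexed by a finite set $S$ and a subspace $H$, a random subset $X$ of $S$ is determinantal associated to $H$ in this basis if $\mathbb P(J\subseteq X)=\det((\Pi^H)^J_J)$ for all $J\subseteq S$, where $\Pi^H$ is the orthogonal projection on $H$ and $(\Pi^H)^J_J$ is the submatrix of its matrix in the basis with rows and columns in $J$. *)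

(* Defs.v *)
From HB Require Import structures.
From mathcomp Require Import all_boot all_order all_algebra sesquilinear.
From mathcomp Require Import boolp reals.
From mathcomp Require Import complex.

Set Implicit Arguments.
Unset Strict Implicit.
Unset Printing Implicit Defensive.

Import Order.TTheory GRing.Theory Num.Theory.
Local Open Scope ring_scope.

(** * Scalars *)

Variant scalar_kind := RealScalars | ComplexScalars.

Definition scalar (R : realType) (kd : scalar_kind) : numFieldType :=
  match kd with RealScalars => R | ComplexScalars => R[i] end.

Definition conjS (R : realType) (kd : scalar_kind) :
    {rmorphism scalar R kd -> scalar R kd} :=
  match kd with
  | RealScalars => (idfun : {rmorphism R -> R})
  | ComplexScalars => (@conjc R : {rmorphism R[i] -> R[i]})
  end.

Definition ofR (R : realType) (kd : scalar_kind) : {rmorphism R -> scalar R kd} :=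
  match kd with
  | RealScalars => (idfun : {rmorphism R -> R})
  | ComplexScalars => (real_complex R : {rmorphism R -> R[i]})
  end.

Definition modulus (R : realType) (kd : scalar_kind) : scalar R kd -> R :=
  match kd with
  | RealScalars => fun z : R => `|z|
  | ComplexScalars => @ComplexField.Normc.normc R
  end.

Lemma conjSK R kd : involutive (conjS R kd).
Proof. by case: kd => //= z; apply: conjcK. Qed.

Lemma conjS_real R kd a : conjS R kd (ofR R kd a) = ofR R kd a.
Proof. by case: kd => //=; apply: conjc_real. Qed.

Lemma ofR_gt0 R kd a : (0 < ofR R kd a) = (0 < a).
Proof. by case: kd => //=; rewrite -(ltcR 0 a). Qed.

Lemma mulS_conj R kd (z : scalar R kd) :
  z * conjS R kd z = ofR R kd (modulus z ^+ 2).
Proof.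
case: kd z => /= z; first by rewrite real_normK ?num_real // expr2.
case: z => a b; rewrite /= sqr_sqrtr ?addr_ge0 ?sqr_ge0 //.
apply/eqP; rewrite eq_complex /= mulrN opprK !expr2 eqxx.
by rewrite mulrN [b * a]mulrC addNr eqxx.
Qed.

Lemma modulus_gt0 R kd (z : scalar R kd) : z != 0 -> 0 < modulus z.
Proof.
case: kd z => /= z; first by rewrite normr_gt0.
move=> z0; rewrite lt_def; apply/andP; split.
  by apply: contra z0 => /eqP/ComplexField.Normc.eq0_normc ->.
by case: {z0} z => a b; apply: sqrtr_ge0.
Qed.

(** * Determinantal random subsets *)

Section Determinantal.
Variables (R : realType) (kd : scalar_kind).
Variables (W : vectType (scalar R kd)) (ip : {dot W for conjS R kd}).

Definition orthproj (H : {vspace W}) : 'End(W) := daddv_pi H (orthov ip H).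

Lemma cap_orthov H : (H :&: orthov ip H = 0)%VS.
Proof.
apply/eqP; rewrite -subv0; apply/subvP => u; rewrite memv_cap memv0.
case/andP=> uH /mem_orthovP/(_ u uH) uu0; apply: contraT => /(@neq0_dnorm_gt0 _ _ _ ip).
by rewrite uu0 ltxx.
Qed.

Variables (S : finType) (b : S -> W).

(* [ip] is linear in its first argument, so the coordinate of [w] on the
   orthonormal vector [b e] is [ip w (b e)]. *)
Definition proj_entry (H : {vspace W}) (e f : S) : scalar R kd :=
  ip (orthproj H (b f)) (b e).

(* The order on rows and columns given by [enum_val] is the same on both sides,
   so the determinant does not depend on it. *)
Definition proj_minor (H : {vspace W}) (J : {set S}) : scalar R kd :=
  \det (\matrix_(i < #|J|, j < #|J|)
          proj_entry H (enum_val i) (enum_val j)).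

(* A random subset of [S] is represented by its law, a probability mass
   function on [{set S}]. *)
Definition is_law (P : {set S} -> R) : Prop :=
  (forall X, 0 <= P X) /\ \sum_X P X = 1.

Definition determinantal (H : {vspace W}) (P : {set S} -> R) : Prop :=
  forall J : {set S}, ofR R kd (\sum_(X : {set S} | J \subset X) P X) = proj_minor H J.

End Determinantal.

(** * Graphs *)

Record ograph := OGraph {
  vertex : finType;
  edge : finType;
  src : edge -> vertex;
  tgt : edge -> vertex;
  einv : edge -> edge;
  einvK : involutive einv;
  einv_neq : forall e, einv e != e;
  src_einv : forall e, src (einv e) = tgt e;
  epos : {set edge};
  epos_einv : forall e, (einv e \in epos) = (e \notin epos)
}.

Record weights (R : realType) (G : ograph) := Weights {
  weight :> edge G -> R;
  weight_gt0 : forall e, 0 < weight e;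
  weight_einv : forall e, weight (einv e) = weight e
}.

Section Subgraphs.
Variable G : ograph.

Lemma tgt_einv (e : edge G) : tgt (einv e) = src e.
Proof. by rewrite -src_einv einvK. Qed.

Definition pos_edge : finType := {e : edge G | e \in epos G}.

(* The inversion-stable edge set identified with [F], a set of positive edges. *)
Definition subgraph_of (F : {set pos_edge}) : {set edge G} :=
  [set e | (e \in val @: F) || (einv e \in val @: F)].

Definition adjacent (S : {set edge G}) : rel (vertex G) :=
  fun u v => [exists e in S, (src e == u) && (tgt e == v)].

Definition connected : Prop := forall u v, connect (adjacent setT) u v.

Definition components (S : {set edge G}) : {set {set vertex G}} :=
  equivalence_partition (connect (adjacent S)) setT.

(* Simple closed paths; loops and pairs of parallel edges are allowed. *)
Definition simple_cycle (c : seq (edge G)) : bool :=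
  [&& c != [::], cycle (fun e f => (src f == tgt e) && (f != einv e)) c
    & uniq (map (@src G) c)].

Definition acyclic (S : {set edge G}) : Prop :=
  forall c, {subset c <= S} -> ~~ simple_cycle c.

Definition forests (k : nat) : {set {set pos_edge}} :=
  [set F | `[< acyclic (subgraph_of F) >] &&
           (#|components (subgraph_of F)| == k.+1)].

(* [T F] enumerates without repetition the vertex sets of [k] of the [k.+1]
   trees of each forest [F], that is, of all of them but one. *)
Definition tree_enum (k : nat) (T : {set pos_edge} -> 'I_k -> {set vertex G}) :=
  forall F, F \in forests k ->
    injective (T F) /\ forall j, T F j \in components (subgraph_of F).

Definition monomial (R : realType) (x : weights R G) (A : {set edge G}) : R :=
  \prod_(e in (A :|: @einv G @: A) :&: epos G) x e.

End Subgraphs.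

(** * Functions and 1-forms *)

Section Forms.
Variables (R : realType) (kd : scalar_kind) (G : ograph) (x : weights R G).
Local Notation K := (scalar R kd).
Local Notation conj := (conjS R kd).

Definition Omega0 : vectType K := {ffun vertex G -> K^o}.

Definition sym_part (a : {ffun edge G -> K^o}) : {ffun edge G -> K^o} :=
  [ffun e => a (einv e) + a e].

Fact sym_part_is_linear : linear sym_part.
Proof.
by move=> c u v; apply/ffunP=> e; rewrite !ffunE scalerDr addrACA.
Qed.
HB.instance Definition _ :=
  GRing.isLinear.Build K _ _ _ sym_part sym_part_is_linear.

Definition antisym : {vspace {ffun edge G -> K^o}} := lker (linfun sym_part).

Lemma antisymP (a : {ffun edge G -> K^o}) :
  reflect (forall e, a (einv e) = - a e) (a \in antisym).
Proof.
rewrite memv_ker lfunE; apply: (iffP eqP) => [/ffunP a0 e|aN].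
  by have := a0 e; rewrite !ffunE => /eqP; rewrite addr_eq0 => /eqP.
by apply/ffunP=> e; rewrite !ffunE aN addNr.
Qed.

Definition Omega1 : vectType K := subvs_of antisym.

Definition form_val (a : Omega1) : {ffun edge G -> K^o} := vsval a.

Lemma form_valN (a : Omega1) e : form_val a (einv e) = - form_val a e.
Proof. by move: e; apply/antisymP; apply: subvsP. Qed.

Fact form_val_is_linear : linear form_val.
Proof. by []. Qed.
HB.instance Definition _ :=
  GRing.isLinear.Build K Omega1 _ _ form_val form_val_is_linear.
Arguments form_val : simpl never.

(* The library's sesquilinear forms are linear in the first argument:
   [dot0 f g] and [dot1 a b] are the inner products <g,f> and <b,a> that are
   antilinear in their first argument. *)
Definition dot0 (f g : Omega0) : K := \sum_v f v * conj (g v).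

Definition dot1 (a b : Omega1) : K :=
  \sum_(e in epos G) ofR R kd (x e) * (form_val a e * conj (form_val b e)).

Fact dot0_is_bilinear : bilinear_for *%R (conjS R kd \; *%R) dot0.
Proof.
split=> w c u v; rewrite /dot0 /=.
  rewrite mulr_sumr -big_split; apply: eq_bigr => i _ /=.
  by rewrite !ffunE mulrDl -mulrA.
rewrite mulr_sumr -big_split; apply: eq_bigr => i _ /=.
by rewrite !ffunE rmorphD rmorphM mulrDr mulrCA.
Qed.
HB.instance Definition _ := bilinear_isBilinear.Build K Omega0 Omega0 K
  *%R (conjS R kd \; *%R) dot0 dot0_is_bilinear.

Fact dot0_is_hermitian (f g : Omega0) :
  dot0 f g = (-1) ^+ false * conj (dot0 g f).
Proof.
rewrite mul1r rmorph_sum; apply: eq_bigr => i _ /=.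
by rewrite rmorphM conjSK mulrC.
Qed.
HB.instance Definition _ := isHermitianSesquilinear.Build K Omega0 false
  (conjS R kd) dot0 dot0_is_hermitian.

Lemma mulS_conj_ge0 (z : K) : 0 <= z * conj z.
Proof.
rewrite mulS_conj; have [->|/modulus_gt0 h] := eqVneq z 0.
  by rewrite -mulS_conj mul0r.
by rewrite ltW // ofR_gt0 exprn_gt0.
Qed.

Lemma mulS_conj_eq0 (z : K) : z * conj z = 0 -> z = 0.
Proof. by move/eqP; rewrite mulf_eq0 fmorph_eq0 orbb => /eqP. Qed.

Fact dot0_pos (f : Omega0) : f != 0 -> 0 < dot0 f f.
Proof.
move=> f0; rewrite lt_def sumr_ge0 ?andbT => [|v _]; last exact: mulS_conj_ge0.
apply: contra f0; rewrite psumr_eq0 => [/allP z|v _]; last exact: mulS_conj_ge0.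
apply/eqP/ffunP=> v; rewrite ffunE; apply/mulS_conj_eq0/eqP.
by apply: (implyP (z v _)); rewrite ?mem_index_enum.
Qed.
HB.instance Definition _ := isDotProduct.Build K Omega0 dot0 dot0_pos.

Fact dot1_is_bilinear : bilinear_for *%R (conjS R kd \; *%R) dot1.
Proof.
split=> w c u v; rewrite /dot1 /=.
  rewrite mulr_sumr -big_split; apply: eq_bigr => i _ /=.
  rewrite linearP !ffunE /= [in RHS]mulrCA -mulrDr; congr (_ * _).
  by rewrite mulrDl -mulrA.
rewrite mulr_sumr -big_split; apply: eq_bigr => i _ /=.
rewrite linearP !ffunE /= [in RHS]mulrCA -mulrDr; congr (_ * _).
by rewrite rmorphD rmorphM mulrDr mulrCA.
Qed.
HB.instance Definition _ := bilinear_isBilinear.Build K Omega1 Omega1 K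
  *%R (conjS R kd \; *%R) dot1 dot1_is_bilinear.

Fact dot1_is_hermitian (a b : Omega1) :
  dot1 a b = (-1) ^+ false * conj (dot1 b a).
Proof.
rewrite mul1r rmorph_sum; apply: eq_bigr => i _ /=.
by rewrite !rmorphM conjS_real conjSK [form_val a i * _]mulrC.
Qed.
HB.instance Definition _ := isHermitianSesquilinear.Build K Omega1 false
  (conjS R kd) dot1 dot1_is_hermitian.

Fact dot1_pos (a : Omega1) : a != 0 -> 0 < dot1 a a.
Proof.
have wgt0 e : 0 < ofR R kd (x e) by rewrite ofR_gt0 weight_gt0.
have tge0 (e : edge G) : e \in epos G ->
    0 <= ofR R kd (x e) * (form_val a e * conj (form_val a e)).
  by move=> _; rewrite mulr_ge0 ?mulS_conj_ge0 // ltW.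
move=> a0; rewrite lt_def sumr_ge0 // andbT.
apply: contra a0; rewrite psumr_eq0 // => /allP z.
have zp e : e \in epos G -> form_val a e = 0.
  move=> ep; apply/mulS_conj_eq0/eqP.
  have := implyP (z e (mem_index_enum e)) ep.
  by rewrite mulf_eq0 gt_eqF.
apply/eqP/val_inj/ffunP=> e; rewrite [RHS]ffunE -[LHS]/(form_val a e).
have [/zp //|en] := boolP (e \in epos G).
apply/eqP; rewrite -oppr_eq0 -form_valN; apply/eqP/zp.
by rewrite epos_einv.
Qed.
HB.instance Definition _ := isDotProduct.Build K Omega1 dot1 dot1_pos.

Definition dform_fun (f : Omega0) : {ffun edge G -> K^o} :=
  [ffun e => f (tgt e) - f (src e)].

Definition dform (f : Omega0) : Omega1 := vsproj antisym (dform_fun f).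

Lemma dformE f e : form_val (dform f) e = f (tgt e) - f (src e).
Proof.
rewrite /form_val vsprojK ?ffunE //; apply/antisymP => e'.
by rewrite !ffunE src_einv tgt_einv opprB.
Qed.

Lemma form_val_inj : injective form_val.
Proof. exact: val_inj. Qed.

Fact dform_is_linear : linear dform.
Proof.
move=> c u v; apply: form_val_inj; apply/ffunP=> e.
rewrite dformE linearP /= !ffunE !dformE.
by rewrite scalerBr opprD addrACA.
Qed.
HB.instance Definition _ := GRing.isLinear.Build K Omega0 Omega1 _ dform
  dform_is_linear.

Definition dmap : 'Hom(Omega0, Omega1) := linfun dform.

Definition vdelta (v : vertex G) : Omega0 := [ffun u => (u == v)%:R].

(* The adjoint of [dmap]: the coordinates of [dstar_fun a] in the orthonormal
   basis [vdelta] are prescribed by adjointness, see [dstarP]. *)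
Definition dstar_fun (a : Omega1) : Omega0 :=
  [ffun v => dot1 a (dmap (vdelta v))].

Fact dstar_fun_is_linear : linear dstar_fun.
Proof.
move=> c u v; apply/ffunP=> w; rewrite !ffunE.
by rewrite (dot1_is_bilinear.1 _ c u v).
Qed.
HB.instance Definition _ := GRing.isLinear.Build K Omega1 Omega0 _ dstar_fun
  dstar_fun_is_linear.

Definition dstar : 'Hom(Omega1, Omega0) := linfun dstar_fun.

Lemma dstarP (a : Omega1) (f : Omega0) : dot0 (dstar a) f = dot1 a (dmap f).
Proof.
have -> : f = \sum_v f v *: vdelta v.
  apply/ffunP=> u; rewrite sum_ffunE (bigD1 u) //= big1 => [|v vu].
    by rewrite !ffunE eqxx addr0 /GRing.scale /= mulr1.
  by rewrite !ffunE eq_sym (negPf vu) scaler0.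
rewrite linear_sumr linear_sum linear_sumr; apply: eq_bigr => v _ /=.
rewrite linearZ /= !linearZr_LR /=; congr (_ * _).
rewrite lfunE /dot0 (bigD1 v) //= big1 => [|u uv].
  by rewrite !ffunE eqxx rmorph1 mulr1 addr0.
by rewrite [vdelta v u]ffunE (negPf uv) rmorph0 mulr0.
Qed.

Definition estar_fun (e : edge G) : {ffun edge G -> K^o} :=
  [ffun f => (f == e)%:R - (f == einv e)%:R].

Definition estar (e : edge G) : Omega1 := vsproj antisym (estar_fun e).

Lemma estarE e f : form_val (estar e) f = (f == e)%:R - (f == einv e)%:R.
Proof.
rewrite /form_val vsprojK ?ffunE //; apply/antisymP => f'.
by rewrite !ffunE opprB (can2_eq (@einvK G) (@einvK G)) (inj_eq (inv_inj (@einvK G))).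
Qed.

Definition edge_basis (e : pos_edge G) : Omega1 :=
  (ofR R kd (Num.sqrt (x (val e))))^-1 *: estar (val e).

Lemma edge_basisE (e f : pos_edge G) :
  form_val (edge_basis e) (val f) =
  (f == e)%:R / ofR R kd (Num.sqrt (x (val e))).
Proof.
rewrite /edge_basis /form_val linearZ !ffunE estarE.
have -> : (val f == einv (val e)) = false.
  by apply/eqP => fe; have := valP f; rewrite fe epos_einv (valP e).
by rewrite subr0 mulrC.
Qed.

Lemma dot1_edge_basis (a : Omega1) (e : pos_edge G) :
  dot1 a (edge_basis e) = ofR R kd (Num.sqrt (x (val e))) * form_val a (val e).
Proof.
rewrite /dot1 (bigD1 (val e)) ?(valP e) //= big1 => [|f /andP[fp fe]].
  rewrite edge_basisE eqxx mul1r addr0 fmorphV conjS_real.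
  rewrite -{1}[x _]sqr_sqrtr ?ltW ?weight_gt0 // expr2 rmorphM -mulrA.
  congr (_ * _); rewrite mulrCA mulfV ?mulr1 //.
  by rewrite fmorph_eq0 gt_eqF // sqrtr_gt0 weight_gt0.
rewrite -[f]/(val (exist (fun e => is_true (e \in epos G)) f fp : pos_edge G)).
rewrite edge_basisE -val_eqE /= (negPf fe) mul0r rmorph0 !mulr0 //.
Qed.

Lemma edge_basis_orthonormal e f :
  dot1 (edge_basis e) (edge_basis f) = (e == f)%:R.
Proof.
rewrite dot1_edge_basis edge_basisE eq_sym mulrCA.
have [->|_] := eqVneq e f; last by rewrite mul0r.
by rewrite mul1r mulfV // fmorph_eq0 gt_eqF // sqrtr_gt0 weight_gt0.
Qed.

Lemma edge_basis_span (a : Omega1) :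
  a = \sum_e dot1 a (edge_basis e) *: edge_basis e.
Proof.
apply/eqP; rewrite -subr_eq0; set b := a - _.
have b0 e : dot1 b (edge_basis e) = 0.
  rewrite linearBl; apply/eqP; rewrite subr_eq0 linear_sumlz (bigD1 e) //= big1.
    by rewrite linearZl_LR /= edge_basis_orthonormal eqxx mulr1 addr0.
  by move=> f fe; rewrite linearZl_LR /= edge_basis_orthonormal (negPf fe) mulr0.
have bp (e : pos_edge G) : form_val b (val e) = 0.
  apply/eqP; have /eqP := b0 e; rewrite dot1_edge_basis mulf_eq0 fmorph_eq0.
  by rewrite gt_eqF // sqrtr_gt0 weight_gt0.
apply/eqP/form_val_inj/ffunP=> e; rewrite [RHS]ffunE.
have bp' f : f \in epos G -> form_val b f = 0.
  by move=> fp; apply: (bp (exist _ f fp)).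
have [/bp' //|en] := boolP (e \in epos G).
by apply/eqP; rewrite -oppr_eq0 -form_valN; apply/eqP/bp'; rewrite epos_einv.
Qed.

Lemma dstar_edge_basis (e : pos_edge G) :
  dstar (edge_basis e) = ofR R kd (Num.sqrt (x (val e))) *:
    (vdelta (tgt (val e)) - vdelta (src (val e))).
Proof.
apply/ffunP=> v; rewrite lfunE ffunE [LHS]hermC mul1r /= dot1_edge_basis.
rewrite lfunE dformE !ffunE rmorphM rmorphB conjS_real !rmorph_nat.
by rewrite ![_ == v]eq_sym.
Qed.

Lemma mem_im_dstar (g : Omega0) :
  connected G -> g \in limg dstar <-> \sum_v (g v : K) = 0.
Proof.
move=> Gc; split=> [/memv_imgP[a _ ->]|g0].
  pose one : Omega0 := [ffun=> 1].
  have -> : \sum_v (dstar a v : K) = dot0 (dstar a) one.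
    by apply: eq_bigr => v _; rewrite [one v]ffunE rmorph1 mulr1.
  rewrite dstarP (_ : dmap one = 0) ?linear0r //.
  by apply: form_val_inj; apply/ffunP=> e; rewrite lfunE dformE !ffunE subrr.
have step e : vdelta (tgt e) - vdelta (src e) \in limg dstar.
  suff h (f : pos_edge G) : vdelta (tgt (val f)) - vdelta (src (val f)) \in limg dstar.
    have [ep|en] := boolP (e \in epos G); first exact: (h (exist _ e ep)).
    have ep : einv e \in epos G by rewrite epos_einv.
    by have := h (exist (fun e => is_true (e \in epos G)) _ ep); rewrite /= src_einv tgt_einv -opprB memvN.
  have s0 : ofR R kd (Num.sqrt (x (val f))) != 0.
    by rewrite fmorph_eq0 gt_eqF // sqrtr_gt0 weight_gt0.
  by rewrite -(scalerK s0 (_ - _)) -dstar_edge_basis memvZ // memv_img ?memvf.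
have conn u v : vdelta v - vdelta u \in limg dstar.
  have /connectP[p] := Gc u v; elim: p u => /= [|w p IHp] u.
    by move=> _ ->; rewrite subrr mem0v.
  case/andP=> /existsP[e /and3P[_ /eqP <- /eqP <-]] /IHp h /h {}h.
  by rewrite -(subrK (vdelta (tgt e)) (vdelta v)) -addrA memvD.
have gE : g = \sum_v g v *: vdelta v.
  apply/ffunP=> u; rewrite sum_ffunE (bigD1 u) //= big1 => [|v vu].
    by rewrite !ffunE eqxx addr0 /GRing.scale /= mulr1.
  by rewrite !ffunE eq_sym (negPf vu) scaler0.
have [/existsP[v0 _]|] := boolP [exists v : vertex G, true]; last first.
  rewrite negb_exists => /forallP nov; rewrite gE big1 ?mem0v // => v.
  by have := nov v.
have -> : g = \sum_v g v *: (vdelta v - vdelta v0).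
  under eq_bigr do rewrite scalerBr.
  by rewrite sumrB -gE -scaler_suml g0 scale0r subr0.
by apply: memv_suml => v _; apply: memvZ; apply: conn.
Qed.

(** * The weighted random spanning forest *)

Section Forest.
Variables (k : nat) (q : k.-tuple Omega0).

Definition Hq : {vspace Omega1} := (dmap @: orthov dot0 <<q>>)%VS.

Lemma HqP (a : Omega1) :
  reflect (exists2 f, forall i, dot0 f (tnth q i) = 0 & a = dmap f) (a \in Hq).
Proof.
apply: (iffP memv_imgP) => [[f /mem_orthovP fq ->]|[f fq ->]]; exists f => //.
  by move=> i; apply: fq; rewrite memv_span // mem_tnth.
apply/mem_orthovP=> g /coord_span ->.
rewrite linear_sum big1 // => i _ /=.
by rewrite linearZr_LR /= -tnth_nth fq mulr0.
Qed.

Variable T : {set pos_edge G} -> 'I_k -> {set vertex G}.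

Definition forest_weight (F : {set pos_edge G}) : R :=
  modulus (\det (\matrix_(i < k, j < k) \sum_(v in T F j) (tnth q i v : K))) ^+ 2
  * monomial x (subgraph_of F).

Definition forest_law (F : {set pos_edge G}) : R :=
  if F \in forests G k
  then forest_weight F / \sum_(F' in forests G k) forest_weight F' else 0.

End Forest.
End Forms.

(* Main.v *)
Require Import Defs.
From mathcomp Require Import all_boot all_order all_algebra sesquilinear.
From mathcomp Require Import reals.
From mathcomp Require Import all_fingroup boolp.

Set Implicit Arguments.
Unset Strict Implicit.
Unset Printing Implicit Defensive.

Import Order.TTheory GRing.Theory Num.Theory.
Local Open Scope ring_scope.

(* Let D be the matrix of d in the orthonormal basis, and let C have as rows
   the q_i together with the evaluation at a vertex v0. For a set J of edges put
     B_J = [ 1_{J^c}  0       D ]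
           [ 0        0   conj C ]
           [ D^T     C^T      0 ].
   Expanding along the first rows, det B_J is a sum over the sets X containing J
   of determinants that are, up to a sign independent of X, the products
   |det N_X|^2, where N_X has the rows of D indexed by X and the rows of C; the
   term is 0 unless N_X is square. It is also 0 unless X is a forest, and for a
   forest, multiplying N_X by an integer matrix of determinant 1 or -1 (adapted
   to the trees of X) gives |det N_X|^2 = |det (q_i(V(T_j)))|^2 x^X.
   On the other hand, solving B_0 (u, c, f) = (a, 0, 0), where B_0 denotes the
   case of the empty J, amounts to splitting a = u + df with df in H_q and u
   orthogonal to H_q. Hence det B_J = det B_0 * det (Pi^J_J). *)

(** * Determinants over finite index types *)

(** Rows and columns follow the same enumeration of [I], so the value depends on the entries only.
    Arbitrary finite index types let edges, constraints and vertices index rows without being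
    numbered. *)
Definition detF (K : comNzRingType) (I : finType) (A : I -> I -> K) : K :=
  \det (\matrix_(i < #|I|, j < #|I|) A (enum_val i) (enum_val j)).

Lemma enum_val_full_bij (I : finType) : bijective (@enum_val I predT).
Proof. exact: enum_val_bij. Qed.

Section DetF.
Variable K : comNzRingType.
Implicit Types I J : finType.

Lemma eq_detF I (A B : I -> I -> K) : A =2 B -> detF A = detF B.
Proof. by move=> AB; congr (\det _); apply/matrixP=> i j; rewrite !mxE AB. Qed.

Lemma detF_tr I (A : I -> I -> K) : detF (fun i j => A j i) = detF A.
Proof. by rewrite /detF -det_tr; congr (\det _); apply/matrixP=> i j; rewrite !mxE. Qed.

(** Two enumerations differ by a permutation acting on both rows and columns, so its sign enters
    twice and cancels. *)
Lemma detF_ordE I n (h : 'I_n -> I) (A : I -> I -> K) : bijective h ->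
  detF A = \det (\matrix_(i < n, j < n) A (h i) (h j)).
Proof.
move=> hB; have E : n = #|I| by rewrite -(card_ord n); apply: bij_eq_card hB.
subst n; have gI' : injective (enum_rank \o h).
  by apply: inj_comp; [apply: enum_rank_inj | apply: bij_inj].
pose s := perm.perm gI'.
rewrite /detF; set M := \matrix_(i, j) _.
have -> : \matrix_(i, j) A (h i) (h j) = row_perm s (col_perm s M).
  by apply/matrixP=> i j; rewrite !mxE !permE /= !enum_rankK.
rewrite row_permE col_permE !det_mulmx !det_perm odd_permV mulrC.
by rewrite -mulrA -signr_addb addbb mulr1.
Qed.

Lemma detF_ord n (A : 'I_n -> 'I_n -> K) : detF A = \det (\matrix_(i, j) A i j).
Proof. by apply: (detF_ordE (h := id)); exists id. Qed.

Lemma detF_bij I J (h : I -> J) (A : J -> J -> K) : bijective h ->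
  detF A = detF (fun i j => A (h i) (h j)).
Proof.
by move=> hB; apply: (detF_ordE A (bij_comp hB (enum_val_full_bij I))).
Qed.

Lemma detF_mul I (A B : I -> I -> K) :
  detF A * detF B = detF (fun i j => \sum_l A i l * B l j).
Proof.
rewrite -det_mulmx; congr (\det _); apply/matrixP=> i j; rewrite !mxE.
rewrite [RHS](reindex _ (onW_bij _ (enum_val_full_bij I))).
by apply: eq_bigr => l _; rewrite !mxE.
Qed.

Lemma detF1 I : detF (fun i j : I => (i == j)%:R : K) = 1.
Proof.
apply: etrans (det1 _ #|I|); congr (\det _); apply/matrixP=> i j; rewrite !mxE.
by rewrite (inj_eq enum_val_inj).
Qed.

Lemma detF_leibniz I (A : I -> I -> K) :
  detF A = \sum_(s : 'S_#|I|) (-1) ^+ s * \prod_i A i (enum_val (s (enum_rank i))).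
Proof.
apply: eq_bigr => s _; congr (_ * _).
rewrite [RHS](reindex _ (onW_bij _ (enum_val_full_bij I))).
by apply: eq_bigr => l _; rewrite !mxE enum_valK.
Qed.

Lemma detF_scale I (s : I -> K) (A : I -> I -> K) :
  detF (fun i j => s i * A i j) = (\prod_i s i) * detF A.
Proof.
rewrite !detF_leibniz mulr_sumr; apply: eq_bigr => t _.
by rewrite big_split mulrCA.
Qed.

Lemma detF_row0 I (A : I -> I -> K) i : (forall j, A i j = 0) -> detF A = 0.
Proof.
move=> A0; rewrite detF_leibniz big1 // => s _.
by rewrite (bigD1 i) //= A0 mul0r mulr0.
Qed.

Lemma detF_ublock I J (A : I + J -> I + J -> K) :
  (forall i j, A (inr j) (inl i) = 0) ->
  detF A = detF (fun i j => A (inl i) (inl j)) * detF (fun i j => A (inr i) (inr j)).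
Proof.
move=> A0; pose h (i : 'I_(#|I| + #|J|)) : I + J :=
  match split i with inl a => inl (enum_val a) | inr b => inr (enum_val b) end.
have hB : bijective h.
  exists (fun x => unsplit match x with
    inl a => inl (enum_rank a) | inr b => inr (enum_rank b) end).
    by move=> i; rewrite /h; case: splitP => j E /=; apply/val_inj; rewrite /= enum_valK E.
  by case=> a; rewrite /h unsplitK enum_rankK.
rewrite (detF_ordE A hB).
rewrite -(det_ublock _ (\matrix_(i, j) A (inl (enum_val i)) (inr (enum_val j)))).
congr (\det _); apply/matrixP=> i j.
by rewrite !mxE /h; case: split => a; rewrite !mxE; case: split => b; rewrite !mxE ?A0.
Qed.


(** With the image of [h] placed first, the matrix is block triangular, with an identity block on
    the indices that [h] misses. *)
Lemma detF_inj I J (h : J -> I) (A : I -> I -> K) : injective h ->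
  (forall i j, i \notin codom h -> A i j = (i == j)%:R) ->
  detF A = detF (fun i j => A (h i) (h j)).
Proof.
move=> hI A1; pose I' : finType := {i : I | i \notin codom h}.
pose g (x : J + I') := match x with inl j => h j | inr i => val i end.
have gI : injective g.
  move=> [j|i] [j'|i'] //=; first by move/hI->.
  - by case: i' => i' ni /= E; case/negP: (ni); rewrite -E codom_f.
  - by case: i => i ni /= E; case/negP: (ni); rewrite E codom_f.
  by move/val_inj->.
have gB : bijective g.
  apply: inj_card_bij => //.
  rewrite -(card_codom gI); apply/subset_leq_card/subsetP=> i _; apply/codomP.
  have [/codomP[j ->]|ni] := boolP (i \in codom h); first by exists (inl j).
  by exists (inr (exist _ i ni)).
rewrite (detF_bij _ gB) detF_ublock => [|j i] /=; last first.
  rewrite A1 ?(valP i) //; case: eqP => // E.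
  by case: i E => i ni /= E; case/negP: (ni); rewrite E codom_f.
rewrite -[RHS]mulr1 -(detF1 I'); congr (_ * _); apply: eq_detF => i j /=.
by rewrite A1 ?(valP i).
Qed.

Lemma detF_inj_col I J (h : J -> I) (A : I -> I -> K) : injective h ->
  (forall i j, j \notin codom h -> A i j = (i == j)%:R) ->
  detF A = detF (fun i j => A (h i) (h j)).
Proof.
move=> hI A1; rewrite -detF_tr (detF_inj hI) => [|i j ni]; first exact: detF_tr.
by rewrite A1 // eq_sym.
Qed.

(** Multilinearity in the rows [inl i]: the set [X] records the rows in which the summand [a] is
    chosen. *)
Lemma detF_expand I J (a b : I -> I + J -> K) (c : J -> I + J -> K) :
  detF (fun i j => match i with inl i => a i j + b i j | inr i => c i j end) =
  \sum_(X : {set I}) detF (fun i j =>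
    match i with inl i => if i \in X then a i j else b i j | inr i => c i j end).
Proof.
rewrite detF_leibniz; under [RHS]eq_bigr do rewrite detF_leibniz.
rewrite exchange_big; apply: eq_bigr => s _ /=.
rewrite -mulr_sumr big_sumType /= bigA_distr mulr_suml; congr (_ * _).
by apply: eq_bigr => X _; rewrite big_sumType.
Qed.


Definition antidiag I J (A : I -> J -> K) (B : J -> I -> K) (x y : I + J) : K :=
  match x, y with
  | inl i, inr j => A i j
  | inr j, inl i => B j i
  | _, _ => 0
  end.

(** The matrix is the block diagonal matrix of [A] and [B] times the matrix swapping the two copies
    of [I]. The sign is left as the determinant of the swap, since it cancels in the end. *)
Lemma detF_antidiag I (A B : I -> I -> K) :
  detF (antidiag A B) =
  detF A * detF B * detF (antidiag (fun i j : I => (i == j)%:R) (fun i j => (i == j)%:R)).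
Proof.
pose C (x y : I + I) : K := match x, y with
    | inl i, inl j => A i j | inr i, inr j => B i j | _, _ => 0 end.
have -> : detF A * detF B = detF C by rewrite detF_ublock.
have sr (f : I -> K) i : \sum_j f j * (j == i)%:R = f i.
  rewrite (bigD1 i) //= eqxx mulr1 big1 ?addr0 // => j ji.
  by rewrite (negPf ji) mulr0.
have s0 (f : I -> K) : \sum_j f j * 0 = 0 by rewrite big1 // => j _; rewrite mulr0.
have s0' (f : I -> K) : \sum_j 0 * f j = 0 by rewrite big1 // => j _; rewrite mul0r.
rewrite detF_mul; apply: eq_detF => -[i|i] [j|j]; rewrite big_sumType /= ?s0' ?s0 ?sr.
all: by rewrite ?add0r ?addr0.
Qed.

(** A permutation with a nonzero Leibniz term exchanges the two summands, which forces them to have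
    the same size. *)
Lemma detF_antidiag0 I J (A : I -> J -> K) (B : J -> I -> K) :
  #|I| != #|J| -> detF (antidiag A B) = 0.
Proof.
move=> IJ; rewrite detF_leibniz big1 // => s _.
pose t x : I + J := enum_val (s (enum_rank x)).
have tI : injective t.
  by move=> x y /enum_val_inj/perm.perm_inj/enum_rank_inj.
pose isl (x : I + J) := if x is inl _ then true else false.
have [/existsP[x xx]|/existsPn nex] := boolP [exists x, isl x == isl (t x)].
  rewrite (bigD1 x) //= (_ : antidiag A B x _ = 0) ?mul0r ?mulr0 //.
  by move: xx; rewrite /t; case: x => x; case: (enum_val _).
have cl : #|isl| = #|I|.
  have /card_codom <- : injective (@inl I J) by move=> ? ? [].
  apply: eq_card => -[i|j]; rewrite [LHS]unfold_in /=; first by rewrite codom_f.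
  by apply/esym/negbTE/codomP => -[].
have cr : #|predC isl| = #|J|.
  have /card_codom <- : injective (@inr I J) by move=> ? ? [].
  apply: eq_card => -[i|j]; rewrite [LHS]unfold_in /=; last by rewrite codom_f.
  by apply/esym/negbTE/codomP => -[].
case/eqP: IJ; apply/eqP; rewrite eqn_leq -cl -cr.
rewrite -{1}(card_image tI isl) -{2}(card_image tI (predC isl)).
apply/andP; split; apply/subset_leq_card/subsetP => _ /imageP[x xI ->].
  have {}xI : isl x = true := xI.
  by rewrite -[t x \in _]/(~~ isl (t x)); have := nex x; rewrite xI; case: (isl _).
have {}xI : isl x = false by apply: negbTE.
by rewrite -[t x \in _]/(isl (t x)); have := nex x; rewrite xI; case: (isl _).
Qed.

(** Reindexing by [g] makes both rectangular blocks square; the remaining sign depends on [J]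
    alone. *)
Lemma detF_antidiag_bij I J (g : J -> I) (A : I -> J -> K) (B : J -> I -> K) :
  bijective g ->
  detF (antidiag A B) =
  detF (fun i j => A (g i) j) * detF (fun i j => B i (g j)) *
  detF (antidiag (fun i j : J => (i == j)%:R) (fun i j => (i == j)%:R)).
Proof.
move=> gB; rewrite -detF_antidiag.
pose h (x : J + J) : I + J := match x with inl i => inl (g i) | inr j => inr j end.
have hB : bijective h.
  case: gB => g' gK g'K.
  exists (fun x : I + J => match x with inl i => inl (g' i) | inr j => inr j end).
    by case=> i //=; rewrite gK.
  by case=> i //=; rewrite g'K.
by rewrite (detF_bij _ hB); apply: eq_detF => -[i|i] [j|j].
Qed.

End DetF.

Lemma detF_map (K L : comNzRingType) (f : {rmorphism K -> L}) (I : finType)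
  (A : I -> I -> K) : detF (fun i j => f (A i j)) = f (detF A).
Proof.
by rewrite -det_map_mx; congr (\det _); apply/matrixP=> i j; rewrite !mxE.
Qed.

Section DetFField.
Variables (K : fieldType) (I : finType).

Lemma detF_neq0 (A : I -> I -> K) :
  (forall u, (forall i, \sum_j A i j * u j = 0) -> forall j, u j = 0) -> detF A != 0.
Proof.
(* [det0P] yields a left null vector, hence the transposition. *)
move=> inj; rewrite -detF_tr; apply/det0P=> -[v v0 vA].
case/eqP: v0; apply/rowP=> i; rewrite mxE.
suff h j : v 0 (enum_rank j) = 0 by rewrite -(enum_valK i).
apply: (inj (fun j => v 0 (enum_rank j))) => {}j.
have /rowP/(_ (enum_rank j)) := vA; rewrite !mxE => {2}<-.
rewrite (reindex _ (onW_bij _ (enum_val_full_bij I))); apply: eq_bigr => l _.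
by rewrite !mxE enum_valK enum_rankK mulrC.
Qed.

Lemma detF_solve (A : I -> I -> K) (b : I -> K) : detF A != 0 ->
  exists u, forall i, \sum_j A i j * u j = b i.
Proof.
rewrite -unitfE -unitmxE => Au.
set M := \matrix_(i, j) _ in Au.
pose w := invmx M *m \col_i b (enum_val i).
exists (fun j => w (enum_rank j) 0) => i.
have /colP/(_ (enum_rank i)) : M *m w = \col_i b (enum_val i) by rewrite mulKVmx.
rewrite !mxE enum_rankK => <-.
rewrite (reindex _ (onW_bij _ (enum_val_full_bij I))); apply: eq_bigr => l _.
by rewrite !mxE enum_valK enum_rankK.
Qed.

End DetFField.

(** * Forests and cycles *)

Section Graph.
Variable G : ograph.
Implicit Types (e f : edge G) (X : {set pos_edge G}) (S : {set edge G}).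

Lemma subgraph_ofV X e : (einv e \in subgraph_of X) = (e \in subgraph_of X).
Proof. by rewrite !inE einvK orbC. Qed.

Lemma val_mem_subgraph_of X (e : pos_edge G) : (val e \in subgraph_of X) = (e \in X).
Proof.
rewrite inE (mem_imset _ _ val_inj); case: imsetP => [[f _ E]|_]; last by rewrite orbF.
by have := epos_einv (val e); rewrite (valP e) E (valP f).
Qed.

Lemma subgraph_ofP X e :
  reflect (exists2 f : pos_edge G, f \in X & e = val f \/ e = einv (val f))
    (e \in subgraph_of X).
Proof.
rewrite inE; apply: (iffP orP) => [[]/imsetP[f fX E]|[f fX [->|->]]].
- by exists f => //; left.
- by exists f => //; right; rewrite -E einvK.
- by left; apply: imset_f.
- by right; rewrite einvK; apply: imset_f.
Qed.

Lemma adjacent_sym X : symmetric (adjacent (subgraph_of X)).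
Proof.
have h u v : adjacent (subgraph_of X) u v -> adjacent (subgraph_of X) v u.
  case/existsP=> e /and3P[eX su tv]; apply/existsP; exists (einv e).
  by rewrite subgraph_ofV eX src_einv tgt_einv tv su.
by move=> u v; apply/idP/idP; apply: h.
Qed.

Lemma connect_adj_sym X : connect_sym (adjacent (subgraph_of X)).
Proof. exact/sym_connect_sym/adjacent_sym. Qed.

Lemma connect_edge X e : e \in subgraph_of X ->
  connect (adjacent (subgraph_of X)) (src e) (tgt e).
Proof. by move=> eX; apply/connect1/existsP; exists e; rewrite eX !eqxx. Qed.

Lemma connect_eq_fun (A : eqType) S (f : vertex G -> A) :
  (forall e, e \in S -> f (tgt e) = f (src e)) ->
  forall u v, connect (adjacent S) u v -> f u = f v.
Proof.
move=> fE u v /connectP[p + ->]; elim: p u => //= w p IHp u /andP[uw /IHp <-].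
by case/existsP: uw => e /and3P[eS /eqP <- /eqP <-]; rewrite fE.
Qed.

Lemma connect_eq_fun_pos (A : eqType) X (f : vertex G -> A) :
  (forall e : pos_edge G, e \in X -> f (tgt (val e)) = f (src (val e))) ->
  forall u v, connect (adjacent (subgraph_of X)) u v -> f u = f v.
Proof.
move=> fE; apply: connect_eq_fun => _ /subgraph_ofP[e eX [|] ->]; first exact: fE.
by rewrite src_einv tgt_einv fE.
Qed.

Let follows e f := (src f == tgt e) && (f != einv e).

(** A simple path of vertices lifts to an edge walk without backtracking. The disjunction prevents a
    return along [e0] at the first step; at later steps its second case holds because the path is
    simple. *)
Lemma path_follows S p e0 : path (adjacent S) (tgt e0) p -> uniq (tgt e0 :: p) ->
    einv e0 \notin S \/ src e0 \notin p ->
  exists c, [/\ path follows e0 c, map (@tgt G) c = p & {subset c <= S}].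
Proof.
elim: p e0 => [|w p IHp] e0 /=; first by exists [::].
case/andP=> /existsP[f /and3P[fS /eqP sf /eqP tf]] pth /andP[]; rewrite inE.
case/norP=> nw np /[dup] uwp /andP[nwp up] h.
have [] := IHp f; rewrite ?tf //; first by right; rewrite sf.
move=> c [cp cm cS]; exists (f :: c); split => /=; last first.
- by move=> g; rewrite inE => /orP[/eqP->//|/cS].
- by rewrite tf cm.
rewrite cp andbT /follows sf eqxx /=; case: h => [|/norP[+ _]].
  by apply: contraNneq => <-.
by apply: contraNneq => E; rewrite -tf E tgt_einv.
Qed.

(** A path joining the ends of [e] without using [e] can be taken simple, and closing it with [e]
    gives a simple cycle. *)
Lemma acyclic_disconnect X (e : pos_edge G) : acyclic (subgraph_of X) -> e \in X ->
  ~~ connect (adjacent (subgraph_of (X :\ e))) (tgt (val e)) (src (val e)).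
Proof.
move=> Xac eX; apply/negP => /connectP[p0 pp0 E].
have := E; case/shortenP: pp0 => p pp up _ {}E.
have nie : einv (val e) \notin subgraph_of (X :\ e).
  by rewrite subgraph_ofV val_mem_subgraph_of !inE eqxx.
have [c [cp cm cS]] := path_follows pp up (or_introl nie).
have cX : {subset val e :: c <= subgraph_of X}.
  move=> g; rewrite inE => /orP[/eqP->|/cS]; first by rewrite val_mem_subgraph_of.
  case/subgraph_ofP=> f /setD1P[_ fX] h; apply/subgraph_ofP; by exists f.
have [] := negP (Xac _ cX); apply/and3P; split=> //=.
  rewrite rcons_path cp /follows /=.
  have -> : tgt (last (val e) c) = last (tgt (val e)) p by rewrite -cm last_map.
  rewrite -E eqxx /=; apply/eqP => ie.
  have : last (val e) c \in val e :: c by rewrite mem_last.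
  rewrite inE => /orP[/eqP le|/cS].
    by move/eqP: ie; rewrite le eq_sym (negPf (einv_neq _)).
  by rewrite -subgraph_ofV -ie val_mem_subgraph_of !inE eqxx.
(* The sources along the closed walk are [src (val e)] and all vertices of the simple path except
   the last, which is [src (val e)] itself; hence they are distinct. *)
have : map (@src G) c = belast (tgt (val e)) p.
  rewrite -cm; elim: c (val e) cp {cm cS cX} => //= f c IHc e0 /andP[/andP[/eqP -> _]].
  by move/IHc->.
by move=> ->; rewrite lastI rcons_uniq -E in up.
Qed.

(** Sources are distinct along a simple cycle, so the inverse of [e], which starts where [e] ends,
    could only be the edge following [e]; backtracking is excluded. *)
Lemma einv_notin_cycle c e : simple_cycle c -> e \in c -> einv e \notin c.
Proof.
case/and3P=> _ cy us ec; apply/negP => iec.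
have /andP[/eqP sn /negP[]] := next_cycle cy ec.
have injs : {in c &, injective (@src G)}.
  elim: c us {cy ec iec sn} => //= h c IHc /andP[nh /IHc {}IHc] f g.
  rewrite !inE => /predU1P[->|fc] /predU1P[->|gc] E //; last exact: IHc.
    by rewrite E map_f in nh.
  by rewrite -E map_f in nh.
apply/eqP/injs; rewrite ?mem_next //.
by rewrite sn src_einv.
Qed.

(* The increments of [f] telescope along a cycle, so an edge carrying the only
   nonzero increment of a subgraph is not on a cycle. *)
Lemma acyclic_increments (K : fieldType) X :
  (forall e : pos_edge G, e \in X ->
     exists f : vertex G -> K, forall e' : pos_edge G, e' \in X ->
     f (tgt (val e')) - f (src (val e')) = (e' == e)%:R) ->
  acyclic (subgraph_of X).
Proof.
move=> inc c cX; apply/negP=> cyc.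
have [c0 cy us] := and3P cyc.
have [e0 e0c] : exists e0, e0 \in c by case: (c) c0 => // e c' _; exists e; rewrite mem_head.
have uc : uniq c by apply: map_uniq us.
have [e eX E] := subgraph_ofP _ _ (cX _ e0c).
have [f fE] := inc e eX.
have tele : \sum_(g <- c) (f (tgt g) - f (src g)) = 0.
  rewrite sumrB; apply/eqP; rewrite subr_eq0.
  have <- : \sum_(g <- c) f (src (next c g)) = \sum_(g <- c) f (tgt g).
    apply: eq_big_seq => g gc; congr f.
    by have /andP[/eqP] := next_cycle cy gc.
  rewrite -(big_map (next c) xpredT (fun g => f (src g))).
  apply/eqP/perm_big/uniq_perm => //.
    rewrite map_inj_in_uniq // => g h gc hc /(congr1 (prev c)).
    by rewrite !prev_next.
  move=> g; apply/mapP/idP => [[h hc ->]|gc]; first by rewrite mem_next.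
  by exists (prev c g); rewrite ?mem_prev // next_prev.
move: tele; rewrite (bigD1_seq e0) //= big_seq_cond big1 ?addr0 => [|g].
  have {}fE := fE e eX; rewrite eqxx in fE.
  move/eqP; case: E => ->; last rewrite src_einv tgt_einv -opprB oppr_eq0.
    by rewrite fE oner_eq0.
  by rewrite fE oner_eq0.
case/andP=> gc ge0; have [e' e'X E'] := subgraph_ofP _ _ (cX _ gc).
(* An edge of the cycle other than [e0] lies over another positive edge, because the cycle does not
   contain the inverse of [e0]. *)
have ne : e' != e.
  apply/eqP=> ee; subst e'.
  have := einv_notin_cycle cyc e0c.
  case: E E' ge0 gc => -> [] ->; rewrite ?einvK ?eqxx // => _ h; by rewrite ?h.
have := fE e' e'X; rewrite (negPf ne).
by case: E' => -> // h; rewrite src_einv tgt_einv -opprB h oppr0.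
Qed.

Definition incidence (K : nzRingType) (e : pos_edge G) (v : vertex G) : K :=
  (v == tgt (val e))%:R - (v == src (val e))%:R.

Lemma sum_incidence (K : nzRingType) (f : vertex G -> K) (e : pos_edge G) :
  \sum_v incidence K e v * f v = f (tgt (val e)) - f (src (val e)).
Proof.
have h w : \sum_v (v == w)%:R * f v = f w.
  rewrite (bigD1 w) //= eqxx mul1r big1 ?addr0 // => v vw.
  by rewrite (negPf vw) mul0r.
by under eq_bigr do rewrite mulrBl; rewrite sumrB !h.
Qed.

Lemma incidence_map (K L : nzRingType) (f : {rmorphism K -> L}) (e : pos_edge G) v :
  f (incidence K e v) = incidence L e v.
Proof. by rewrite rmorphB !rmorph_nat. Qed.

Definition edge_in X : finType := {e : pos_edge G | e \in X}.

(** * Unimodularity of the rooted incidence matrix of a forest *)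

Section RootedForest.
Variables (X : {set pos_edge G}) (Xac : acyclic (subgraph_of X)).
Variables (Th : finType) (tau : vertex G -> Th) (r : Th -> vertex G).
Hypothesis tau_r : cancel r tau.
Hypothesis tau_connect :
  forall u v, (tau u == tau v) = connect (adjacent (subgraph_of X)) u v.

Lemma tau_edge (e : pos_edge G) : e \in X -> tau (tgt (val e)) = tau (src (val e)).
Proof.
move=> eX; apply/eqP; rewrite eq_sym tau_connect; apply: connect_edge.
by rewrite val_mem_subgraph_of.
Qed.

(** The incidence rows of [X] are completed by one evaluation per root. Integer entries are kept so
    that invertibility forces the determinant to be 1 or -1. *)
Definition rooted_mx (i : edge_in X + Th) (v : vertex G) : int :=
  match i with
  | inl e => incidence int (val e) v
  | inr t => (v == r t)%:R
  end.

(** Once [e] is removed from a forest, this is the indicator of the piece containing its target; its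
    only nonzero increment along the forest is at [e]. *)
Definition far_side (e : pos_edge G) (v : vertex G) : int :=
  (connect (adjacent (subgraph_of (X :\ e))) (tgt (val e)) v)%:R.

(* Column [inl e] is the function, null at the roots, whose increments along
   the forest are concentrated on [e]. *)
Definition rooted_inv (v : vertex G) (i : edge_in X + Th) : int :=
  match i with
  | inl e => far_side (val e) v - far_side (val e) (r (tau v))
  | inr t => (tau v == t)%:R
  end.

Lemma far_side_increment (e e' : pos_edge G) : e \in X -> e' \in X ->
  far_side e (tgt (val e')) - far_side e (src (val e')) = (e' == e)%:R.
Proof.
move=> eX e'X; rewrite /far_side; have [->|ne] := eqVneq e' e.
  by rewrite connect0 (negPf (acyclic_disconnect Xac eX)) subr0.
have /(same_connect_r (@connect_adj_sym _)) -> : 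
    connect (adjacent (subgraph_of (X :\ e))) (src (val e')) (tgt (val e')).
  by apply: connect_edge; rewrite val_mem_subgraph_of !inE ne.
by rewrite subrr.
Qed.

Lemma rooted_mxK i j : \sum_v rooted_mx i v * rooted_inv v j = (i == j)%:R.
Proof.
case: i => [e|t].
  rewrite sum_incidence; case: j => [e'|t] /=.
    by rewrite tau_edge ?(valP e) // opprB addrA subrK far_side_increment ?(valP e) ?(valP e').
  by rewrite tau_edge ?(valP e) // subrr.
rewrite (bigD1 (r t)) //= eqxx mul1r big1 ?addr0 => [|v vr]; last first.
  by rewrite (negPf vr) mul0r.
by case: j => [e|t'] /=; rewrite tau_r ?subrr.
Qed.

(** A function without increments along [X] is constant on each tree, and its value at the root is
    0. *)
Lemma rooted_mx_inj (f : vertex G -> int) :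
  (forall i, \sum_v rooted_mx i v * f v = 0) -> forall v, f v = 0.
Proof.
move=> h v; have hr t : f (r t) = 0.
  rewrite -[RHS](h (inr t)) (bigD1 (r t)) //= eqxx mul1r big1 ?addr0 // => u ur.
  by rewrite (negPf ur) mul0r.
rewrite -(hr (tau v)); apply: (connect_eq_fun_pos (X := X)) => [e eX|].
  have := h (inl (exist _ e eX)); rewrite sum_incidence /= => /eqP.
  by rewrite subr_eq0 => /eqP.
by rewrite -tau_connect tau_r.
Qed.

(** The two index types are not yet known to be equinumerous, so the other one-sided inverse does
    not suffice. Injectivity of [rooted_mx] is applied to each column of the difference of the two
    sides. *)
Lemma rooted_invK u v : \sum_i rooted_inv u i * rooted_mx i v = (u == v)%:R.
Proof.
apply/eqP; rewrite -subr_eq0; apply/eqP.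
apply: (rooted_mx_inj (f := fun u => \sum_i rooted_inv u i * rooted_mx i v - (u == v)%:R)).
move=> i; under eq_bigr do rewrite mulrBr mulr_sumr.
rewrite sumrB exchange_big /=.
under eq_bigr => j _ do
  (under eq_bigr do rewrite mulrA; rewrite -mulr_suml rooted_mxK).
rewrite (bigD1 i) //= eqxx mul1r big1 ?addr0 => [|j ji]; last first.
  by rewrite eq_sym (negPf ji) mul0r.
rewrite (bigD1 v) //= eqxx mulr1 big1 ?addr0 ?subrr // => w wv.
by rewrite (negPf wv) mulr0.
Qed.

(** A matrix with a two-sided inverse is square. *)
Lemma forest_card : (#|X| + #|Th|)%N = #|vertex G|.
Proof.
have -> : (#|X| + #|Th|)%N = #|{: edge_in X + Th}| by rewrite card_sum card_sig.
pose A := \matrix_(i < #|{: edge_in X + Th}|, j < #|vertex G|)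
   rooted_mx (enum_val i) (enum_val j).
pose B := \matrix_(i < #|vertex G|, j < #|{: edge_in X + Th}|)
   rooted_inv (enum_val i) (enum_val j).
have AB : A *m B = 1%:M.
  apply/matrixP=> i j; rewrite !mxE -(inj_eq enum_val_inj) -rooted_mxK.
  rewrite [RHS](reindex _ (onW_bij _ (enum_val_full_bij _))).
  by apply: eq_bigr => v _; rewrite !mxE.
have BA : B *m A = 1%:M.
  apply/matrixP=> i j; rewrite !mxE -(inj_eq enum_val_inj) -rooted_invK.
  rewrite [RHS](reindex _ (onW_bij _ (enum_val_full_bij _))).
  by apply: eq_bigr => v _; rewrite !mxE.
by apply/eqP; rewrite eqn_leq (mulmx1_min AB) (mulmx1_min BA).
Qed.

(** The determinant is an invertible integer. It is squared because its sign depends on [g]. *)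
Lemma rooted_inv_det (g : vertex G -> edge_in X + Th) : bijective g ->
  detF (fun u v => rooted_inv u (g v)) ^+ 2 = 1.
Proof.
move=> gB.
have : detF (fun u v => rooted_inv u (g v)) * detF (fun u v => rooted_mx (g u) v) = 1.
  rewrite detF_mul -[RHS](detF1 _ (vertex G)); apply: eq_detF => u v.
  by rewrite -rooted_invK [RHS](reindex _ (onW_bij _ gB)).
move=> E; have : detF (fun u v => rooted_inv u (g v)) \is a GRing.unit.
  by apply/unitrPr; eexists; apply: E.
by case/orP=> /eqP->; rewrite ?expr1n ?sqrrN ?expr1n.
Qed.
End RootedForest.
End Graph.

(** * The determinant of N_X in terms of the trees of X *)

Section ForestDeterminant.
Variables (K : fieldType) (G : ograph) (k : nat).
Variables (q : 'I_k -> vertex G -> K) (v0 : vertex G).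
Implicit Type X : {set pos_edge G}.

(** The evaluation at [v0] fixes the additive constant that d does not see. *)
Definition constraint (t : option 'I_k) (v : vertex G) : K :=
  match t with None => (v == v0)%:R | Some i => q i v end.

Definition forest_mx X (i : edge_in X + option 'I_k) (v : vertex G) : K :=
  match i with
  | inl e => incidence K (val e) v
  | inr t => constraint t v
  end.

(** Solving the nonsingular system with a unit right-hand side at [e] gives a function whose only
    increment along [X] is at [e]. *)
Lemma forest_mx_acyclic X (g : vertex G -> edge_in X + option 'I_k) :
  bijective g -> detF (fun u v => forest_mx (g u) v) != 0 -> acyclic (subgraph_of X).
Proof.
case=> g' gK g'K d0; apply: (acyclic_increments (K := K)) => e eX.
have [f fE] := detF_solve (fun u => (g u == inl (exist _ e eX))%:R) d0.
exists f => e' e'X; have := fE (g' (inl (exist _ e' e'X))).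
by rewrite g'K /= sum_incidence.
Qed.

Hypothesis q0 : forall i, \sum_v q i v = 0.

(** After multiplication by [rooted_inv] the edge rows are those of the identity, and what remains
    is the matrix [M] of the sums of the constraints over the trees. *)
Lemma forest_mx_det X (tau : vertex G -> option 'I_k) (r : option 'I_k -> vertex G)
    (g : vertex G -> edge_in X + option 'I_k) :
  acyclic (subgraph_of X) -> cancel r tau ->
  (forall u v, (tau u == tau v) = connect (adjacent (subgraph_of X)) u v) ->
  bijective g ->
  exists2 s : int, s ^+ 2 = 1 & detF (fun u v => forest_mx (g u) v) =
    s%:~R * detF (fun i j : 'I_k => \sum_(v | tau v == Some j) q i v).
Proof.
move=> Xac tau_r tau_c gB; have s2 := rooted_inv_det Xac tau_r tau_c gB.
set s := detF _ in s2; exists s => //; set Q := detF (fun i j : 'I_k => _).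
pose M t t' := \sum_v constraint t v * (tau v == t')%:R.
have dN : detF (fun u v => forest_mx (g u) v) * s%:~R = detF M.
  rewrite -(detF_map (intmul 1)) detF_mul.
  pose NY (i j : edge_in X + option 'I_k) : K := \sum_v forest_mx i v * (rooted_inv tau r v j)%:~R.
  have -> : detF M = detF NY.
    rewrite (@detF_inj _ (edge_in X + option 'I_k)%type _ inr) => [|? ? []//|[e|t] j].
    - apply: eq_detF => t t'; apply: eq_bigr => v _.
      by rewrite /= rmorph_nat.
    - move=> _; rewrite -(rmorph_nat (intmul 1)) -(rooted_mxK Xac tau_r tau_c) rmorph_sum /=.
      by apply: eq_bigr => v _; rewrite rmorphM /= incidence_map.
    by rewrite codom_f.
  by rewrite (detF_bij _ gB).
have dM : detF M = Q.
  (* Multiplying by [U] replaces the column of the tree [None] by the sum of all columns. Each [q i]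
     has total 0 and the evaluation at [v0] has total 1, so this column becomes a unit vector and
     the tree [None] drops out. *)
  pose U (t t' : option 'I_k) : K := if t' is None then 1 else (t == t')%:R.
  have dU : detF U = 1.
    rewrite (detF_inj_col (h := fun _ : unit => None)) => [|[] []//|i [j|]//].
      by rewrite -[RHS](detF1 _ unit); apply: eq_detF => -[] [].
    by case/codomP; exists tt.
  rewrite -[LHS]mulr1 -dU detF_mul (detF_inj_col (h := some)).
  - apply: eq_detF => i j; rewrite (bigD1 (Some j)) //= eqxx mulr1 big1.
      rewrite addr0 /M /= [RHS]big_mkcond; apply: eq_bigr => v _.
      by case: eqP; rewrite ?mulr0 ?mulr1.
    by move=> t tj; rewrite (negPf tj) mulr0.
  - by move=> ? ? [].
  move=> t [j|]; first by rewrite codom_f.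
  move=> _; under eq_bigr do rewrite mulr1.
  rewrite exchange_big /=; under eq_bigr => v _.
    rewrite -mulr_sumr (bigD1 (tau v)) //= eqxx big1 ?addr0 ?mulr1; first over.
    by move=> t' t'v; rewrite eq_sym (negPf t'v).
  case: t => [i|] /=; first by rewrite q0.
  by rewrite (bigD1 v0) //= eqxx big1 ?addr0 // => v /negPf->.
rewrite -dM -dN mulrC -mulrA -rmorphM -expr2 s2 /= mulr1 //.
Qed.
End ForestDeterminant.

(** * Components and edge counts of forests *)

Section Components.
Variable G : ograph.
Implicit Type X : {set pos_edge G}.

Lemma connect_equivalence X :
  {in setT & &, equivalence_rel (connect (adjacent (subgraph_of X)))}.
Proof.
move=> u v w _ _ _; split; first exact: connect0.
by move=> uv; apply: (same_connect (@connect_adj_sym _ X) uv).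
Qed.

Lemma mem_component X C u v : C \in components (subgraph_of X) -> u \in C ->
  (v \in C) = connect (adjacent (subgraph_of X)) u v.
Proof.
move=> Cc uC; rewrite -(pblock_equivalence_partition (connect_equivalence X)) ?inE //.
have /and3P[_ tI _] := equivalence_partitionP (connect_equivalence X).
by rewrite (def_pblock tI Cc uC).
Qed.

(** An injective family of components with the right cardinality lists them all. Then [tau] reads
    off the index of the component of a vertex, and [r] picks a vertex in each component. *)
Lemma components_classifier X (Th : finType) (b : Th -> {set vertex G}) :
  injective b -> (forall t, b t \in components (subgraph_of X)) ->
  #|Th| = #|components (subgraph_of X)| ->
  exists tau : vertex G -> Th, exists r : Th -> vertex G,
  [/\ cancel r tau,
      forall u v, (tau u == tau v) = connect (adjacent (subgraph_of X)) u v &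
      forall v t, (tau v == t) = (v \in b t)].
Proof.
move=> bI bc bcard.
have /and3P[/eqP cov tI n0] := equivalence_partitionP (connect_equivalence X).
have bE C : C \in components (subgraph_of X) -> exists t, b t = C.
  suff -> : components (subgraph_of X) = [set b t | t in Th].
    by case/imsetP=> t _ ->; exists t.
  apply/esym/eqP; rewrite eqEcard -bcard card_imset //.
  rewrite leqnn andbT.
  by apply/subsetP=> _ /imsetP[t _ ->].
have exb v : exists t, v \in b t.
  have : v \in cover (components (subgraph_of X)) by rewrite cov inE.
  by case/bigcupP=> C /bE[t <-] ?; exists t.
have exr t : exists v, v \in b t.
  by apply/set0Pn/eqP => b0; rewrite -b0 bc in n0.
exists (fun v => xchoose (exb v)), (fun t => xchoose (exr t)).
have tauP v := xchooseP (exb v); have rP t := xchooseP (exr t).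
have tauE v t : (xchoose (exb v) == t) = (v \in b t).
  apply/eqP/idP => [<- //|vt]; apply: bI.
  by rewrite -(def_pblock tI (bc _) (tauP v)) -(def_pblock tI (bc _) vt).
split=> // [t|u v]; first by apply/eqP; rewrite tauE.
by rewrite eq_sym tauE; apply: mem_component.
Qed.

Lemma acyclic_card X : acyclic (subgraph_of X) ->
  (#|X| + #|components (subgraph_of X)|)%N = #|vertex G|.
Proof.
move=> Xac; pose Th : finType := {C | C \in components (subgraph_of X)}.
have [||tau [r [h1 h2 _]]] := @components_classifier X Th val val_inj.
- exact: valP.
- by rewrite card_sig.
by rewrite -(forest_card Xac h1 h2) card_sig.
Qed.

(** In a forest, edges and trees together are as many as vertices; the number of trees is thus
    prescribed by the number of edges, which is what the squareness of N_X controls. *)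
Lemma mem_forests k X :
  (X \in forests G k) <-> acyclic (subgraph_of X) /\ (#|X| + k.+1)%N = #|vertex G|.
Proof.
rewrite inE; split=> [/andP[/asboolP Xac /eqP <-]|[Xac]].
  by rewrite acyclic_card.
rewrite -(acyclic_card Xac) => /addnI ->; rewrite eqxx andbT; exact/asboolP.
Qed.

(** The label [None] goes to the one tree that [T] omits. *)
Lemma forest_classifier k X (T : 'I_k -> {set vertex G}) :
  X \in forests G k -> injective T ->
  (forall j, T j \in components (subgraph_of X)) ->
  exists tau : vertex G -> option 'I_k, exists r : option 'I_k -> vertex G,
  [/\ cancel r tau,
      forall u v, (tau u == tau v) = connect (adjacent (subgraph_of X)) u v &
      forall v j, (tau v == Some j) = (v \in T j)].
Proof.
rewrite inE => /andP[_ /eqP cX] TI Tc.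
have [C0 C0c nT] : exists2 C0, C0 \in components (subgraph_of X) & C0 \notin codom T.
  apply/subsetPn/negP => /subset_leq_card.
  by rewrite card_codom // card_ord cX ltnn.
pose b t := if t is Some j then T j else C0.
have [|||tau [r [h1 h2 h3]]] := @components_classifier X (option 'I_k) b.
- move=> [i|] [j|] //=; first by move/TI->.
    by move=> E; rewrite -E codom_f in nT.
  by move=> E; rewrite E codom_f in nT.
- by case.
- by rewrite card_option card_ord cX.
by exists tau, r; split=> // v j; apply: h3.
Qed.

End Components.

(** * Expansion of the bordered determinant over edge sets *)

Section Bordered.
Variables (K : fieldType) (cj : {rmorphism K -> K}) (G : ograph) (k : nat).
Variables (q : 'I_k -> vertex G -> K) (v0 : vertex G) (s : pos_edge G -> K).
Hypothesis cj_s : forall e, cj (s e) = s e.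
Implicit Types J X : {set pos_edge G}.

Notation Idx := (pos_edge G + (option 'I_k + vertex G))%type.

Definition edge_row (e : pos_edge G) (j : Idx) : K :=
  if j is inr (inr v) then s e * incidence K e v else 0.

Definition border_row (i : option 'I_k + vertex G) (j : Idx) : K :=
  match i, j with
  | inl t, inr (inr v) => cj (constraint q v0 t v)
  | inr v, inl e => s e * incidence K e v
  | inr v, inr (inl t) => constraint q v0 t v
  | _, _ => 0
  end.

(** This is B_J, with each edge row written as a sum of two rows, ready for multilinear
    expansion. *)
Definition bordered J (i j : Idx) : K :=
  match i with
  | inl e => edge_row e j + (if e \in J then 0 else (inl e == j)%:R)
  | inr i => border_row i j
  end.

Definition selected X (i j : Idx) : K :=
  match i with
  | inl e => if e \in X then edge_row e j else (inl e == j)%:R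
  | inr i => border_row i j
  end.

(** If some [e] lies in [J] but not in [X], the row of [e] in the term of [X] is zero. *)
Lemma bordered_expand J :
  detF (bordered J) = \sum_(X : {set pos_edge G} | J \subset X) detF (selected X).
Proof.
rewrite detF_expand [RHS]big_mkcond; apply: eq_bigr => X _.
case: ifPn => [JX|/subsetPn[e eJ eX]].
  apply: eq_detF => -[e|i] j //=; case: ifPn => // eX.
  by case: ifPn => // eJ; rewrite (subsetP JX _ eJ) in eX.
by apply: (detF_row0 (i := inl e)) => j; rewrite (negPf eX) eJ.
Qed.

Definition scale X (i : edge_in X + option 'I_k) : K :=
  if i is inl e then s (val e) else 1.

(** The edge rows outside [X] are identity rows and drop out. As [s] is fixed by [cj], the remaining
    blocks are the conjugate of N_X and its transpose, whence the squared modulus. *)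
Lemma selected_antidiag X : detF (selected X) =
  detF (antidiag (fun i v => cj (scale i * forest_mx q v0 i v))
                 (fun v (i : edge_in X + option 'I_k) => scale i * forest_mx q v0 i v)).
Proof.
pose h (x : (edge_in X + option 'I_k) + vertex G) : Idx :=
  match x with
  | inl (inl e) => inl (val e)
  | inl (inr t) => inr (inl t)
  | inr v => inr (inr v)
  end.
rewrite (@detF_inj _ Idx _ h).
- apply: eq_detF => -[[e|t]|v] [[e'|t']|v'] //=; rewrite ?(valP e) ?mul1r //.
  by rewrite rmorphM cj_s incidence_map.
- move=> [[e|t]|v] [[e'|t']|v'] //= [] //; first by move/val_inj->.
  + by move->.
  by move->.
move=> [e|[t|v]] j /= ni.
- case: ifPn ni => // eX /codomP[]; by exists (inl (inl (exist _ e eX))).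
- by case/codomP: ni; exists (inl (inr t)).
by case/codomP: ni; exists (inr v).
Qed.

(** The sign common to all [X]: the surviving N_X are square of size the number of vertices. *)
Definition swap_det : K :=
  detF (antidiag (fun i j : vertex G => (i == j)%:R) (fun i j => (i == j)%:R)).

Hypothesis q0 : forall i, \sum_v q i v = 0.

Lemma selected_forest X (T : 'I_k -> {set vertex G}) :
  X \in forests G k -> injective T ->
  (forall j, T j \in components (subgraph_of X)) ->
  let d := \det (\matrix_(i < k, j < k) \sum_(v in T j) q i v) in
  detF (selected X) = d * cj d * (\prod_(e in X) s e) ^+ 2 * swap_det.
Proof.
move=> XF TI Tc; have [Xac Xc] := (mem_forests _ _).1 XF.
have [tau [r [h1 h2 h3]]] := forest_classifier XF TI Tc.
have cI : #|{: edge_in X + option 'I_k}| = #|vertex G|.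
  by rewrite card_sum card_sig card_option card_ord.
have [g gB] : exists g : vertex G -> edge_in X + option 'I_k, bijective g.
  exists (fun v => enum_val (cast_ord (esym cI) (enum_rank v))).
  exists (fun i => enum_val (cast_ord cI (enum_rank i))) => i;
  by rewrite enum_valK ?cast_ordK ?cast_ordKV enum_rankK.
move=> d; have [z z2 E] := forest_mx_det v0 q0 Xac h1 h2 gB.
have {}E : detF (fun u v => forest_mx q v0 (g u) v) = z%:~R * d.
  rewrite E detF_ord; congr (_ * \det _); apply/matrixP=> i j; rewrite !mxE.
  by apply: eq_bigl => v; rewrite h3.
have P : \prod_v scale (g v) = \prod_(e in X) s e.
  transitivity (\prod_i @scale X i); first by rewrite [RHS](reindex _ (onW_bij _ gB)).
  by rewrite big_sumType /= [X in _ * X]big1 // mulr1 [RHS]big_sub.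
have cjP : cj (\prod_(e in X) s e) = \prod_(e in X) s e.
  by rewrite rmorph_prod; apply: eq_bigr => e _; rewrite cj_s.
(* The sign [z] occurs once in each block, and conjugation fixes it. *)
have zz : z%:~R * z%:~R = 1 :> K by rewrite -rmorphM -expr2 z2.
rewrite selected_antidiag (detF_antidiag_bij _ _ gB); congr (_ * _).
rewrite detF_map -[X in _ * X]detF_tr detF_scale E P !rmorphM rmorph_int cjP.
by rewrite mulrACA [z%:~R * _ * _]mulrACA zz mul1r -expr2 mulrC [d * _]mulrC.
Qed.

(** Either N_X is not square, or it is singular: a nonzero determinant would make [X] acyclic, and
    its number of edges would then make it a forest with k+1 trees. *)
Lemma selected_not_forest X : X \notin forests G k -> detF (selected X) = 0.
Proof.
move=> nF; rewrite selected_antidiag.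
have [cI|cI] := eqVneq #|{: edge_in X + option 'I_k}| #|vertex G|; last first.
  exact: detF_antidiag0.
have [g gB] : exists g : vertex G -> edge_in X + option 'I_k, bijective g.
  exists (fun v => enum_val (cast_ord (esym cI) (enum_rank v))).
  exists (fun i => enum_val (cast_ord cI (enum_rank i))) => i;
  by rewrite enum_valK ?cast_ordK ?cast_ordKV enum_rankK.
have d0 : detF (fun u v => forest_mx q v0 (g u) v) = 0.
  apply/eqP; apply: contraNT nF => /(forest_mx_acyclic gB) Xac; apply/mem_forests.
  by split=> //; rewrite -cI card_sum card_sig card_option card_ord.
rewrite (detF_antidiag_bij _ _ gB) -[X in _ * X * _]detF_tr detF_scale d0.
by rewrite mulr0 mulr0 mul0r.
Qed.

End Bordered.

(** * Orthogonal projections and the bordered matrix *)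

Section OrthogonalDecomposition.
Variables (R : realType) (kd : scalar_kind).
Variables (W : vectType (Defs.scalar R kd)) (ip : {dot W for conjS R kd}).
Implicit Types H : {vspace W}.

(** The orthogonal of [H] is the intersection of the orthogonals of the vectors of a basis, each of
    which lowers the dimension by at most one. *)
Lemma leq_dim_orthov H : (\dim {:W} <= \dim (orthov ip H) + \dim H)%N.
Proof.
have dim_cap n (b : nat -> W) :
    (\dim {:W} <= \dim (\bigcap_(i < n) orthov ip <[b i]>)%VS + n)%N.
  elim: n => [|n IHn]; first by rewrite big_ord0 addn0.
  rewrite big_ord_recr /= addnS; apply: leq_trans IHn _.
  have := leq_dim_orthov1 ip (b n) (\bigcap_(i < n) orthov ip <[b i]>)%VS.
  by rewrite -subn1 leq_subLR add1n -(leq_add2r n) addSn.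
have -> : orthov ip H = (\bigcap_(i < \dim H) orthov ip <[(vbasis H)`_i]>)%VS.
  by apply: eq_bigr => i _; rewrite orthov1E.
exact: dim_cap.
Qed.

Lemma orthovD_full H : (H + orthov ip H = {:W})%VS.
Proof.
apply/eqP; rewrite eqEdim subvf dimv_disjoint_sum ?cap_orthov //.
by rewrite addnC leq_dim_orthov.
Qed.

Lemma mem_orthproj H u : orthproj ip H u \in H.
Proof. exact: memv_pi. Qed.

Lemma sub_orthproj H u : u - orthproj ip H u \in orthov ip H.
Proof.
have uHH : u \in (H + orthov ip H)%VS by rewrite orthovD_full memvf.
rewrite -{1}(daddv_pi_add (cap_orthov ip H) uHH) addrAC subrr add0r.
exact: memv_pi.
Qed.

Lemma dot_eq0 u : ip u u = 0 -> u = 0.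
Proof.
move=> uu; apply/eqP; apply: contraT => /(@neq0_dnorm_gt0 _ _ _ ip).
by rewrite uu ltxx.
Qed.

(** The difference between [u] and its projection is orthogonal to [u] by hypothesis and to the
    projection by construction, hence to itself. *)
Lemma orthovK H u : (forall v, v \in orthov ip H -> ip u v = 0) -> u \in H.
Proof.
move=> uH; set p := orthproj ip H u.
have wH : u - p \in orthov ip H by apply: sub_orthproj.
suff /eqP : u - p = 0 by rewrite subr_eq0 => /eqP ->; apply: mem_orthproj.
apply: dot_eq0; rewrite [LHS]linearBl /= uH // sub0r; apply/eqP; rewrite oppr_eq0 herm_eq0C.
by move/mem_orthovP: wH => ->; rewrite ?mem_orthproj.
Qed.
End OrthogonalDecomposition.

(** * Kernel and solutions of the bordered system *)

Section ForestLaw.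
Variables (R : realType) (kd : scalar_kind) (G : ograph) (x : weights R G).
Variables (k : nat) (q : k.-tuple (Omega0 R kd G)) (v0 : vertex G).
Local Notation K := (Defs.scalar R kd).
Local Notation cj := (conjS R kd).
Local Notation bs := (edge_basis kd x).
Implicit Types (e : pos_edge G) (f : Omega0 R kd G) (a : Omega1 R kd G).

Definition qfun (i : 'I_k) (v : vertex G) : K := tnth q i v.
Definition sqrt_weight e : K := ofR R kd (Num.sqrt (x (val e))).
Local Notation C := (constraint qfun v0).
Local Notation s := sqrt_weight.
Local Notation B := (bordered cj qfun v0 s).

Lemma cj_sqrt_weight e : cj (s e) = s e.
Proof. exact: conjS_real. Qed.

Lemma dstar_basisE e v : dstar kd x (bs e) v = s e * incidence K e v.
Proof. by rewrite dstar_edge_basis !ffunE. Qed.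

Lemma dot1_dmap_basis f e :
  dot1 x (dmap R kd G f) (bs e) = \sum_v s e * incidence K e v * f v.
Proof.
rewrite dot1_edge_basis lfunE dformE -(sum_incidence (f : vertex G -> K)) mulr_sumr.
by apply: eq_bigr => v _; rewrite mulrA.
Qed.

Lemma dstar_coord a v :
  dstar kd x a v = \sum_e s e * incidence K e v * dot1 x a (bs e) :> K.
Proof.
rewrite {1}(edge_basis_span x a) linear_sum sum_ffunE; apply: eq_bigr => e _.
by rewrite linearZ /= ffunE dstar_basisE; apply: mulrC.
Qed.

Lemma omega1_eq0 a : (forall e, dot1 x a (bs e) = 0) -> a = 0.
Proof.
by move=> a0; rewrite (edge_basis_span x a) big1 // => e _; rewrite a0 scale0r.
Qed.

(** First of the three block rows of B_0 (a, c, f), which read a + df, the constraints on f, and d^*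
    a plus the combination of the constraints with coefficients c. *)
Lemma bordered_edge e u :
  \sum_j B set0 (inl e) j * u j = u (inl e) + \sum_v s e * incidence K e v * u (inr (inr v)).
Proof.
rewrite !big_sumType /= !in_set0 (bigD1 e) //= big1 => [|e' e'e]; last first.
  by rewrite add0r [_ == _]eq_sym -[_ == _]/(e' == e) (negPf e'e) mul0r.
rewrite [X in _ + (X + _)]big1 => [|t _]; last by rewrite addr0 mul0r.
rewrite eqxx add0r mul1r addr0 add0r; congr (_ + _).
by apply: eq_bigr => v _; rewrite addr0.
Qed.

Lemma bordered_constraint t u :
  \sum_j B set0 (inr (inl t)) j * u j = \sum_v cj (C t v) * u (inr (inr v)).
Proof.
rewrite !big_sumType /= big1 => [|e _]; last by rewrite mul0r.
by rewrite big1 ?add0r // => t' _; rewrite mul0r.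
Qed.

Lemma bordered_vertex v u :
  \sum_j B set0 (inr (inr v)) j * u j =
  \sum_e s e * incidence K e v * u (inl e) + \sum_t C t v * u (inr (inl t)).
Proof.
rewrite !big_sumType /=; congr (_ + _).
by rewrite [X in _ + X]big1 ?addr0 // => w _; rewrite mul0r.
Qed.

Hypothesis conG : connected G.
Hypothesis freeq : free q.
Hypothesis q0 : forall i, \sum_v qfun i v = 0.

Lemma dmap_eq0 f u v : dmap R kd G f = 0 -> f u = f v.
Proof.
move=> df; apply: (connect_eq_fun (S := setT)) (conG u v) => e _.
have := dformE f e; rewrite -[dform f](lfunE (dform (G := G))) df.
rewrite linear0 ffunE => /esym/eqP.
by rewrite subr_eq0 => /eqP.
Qed.

(** Summing over the vertices kills the [q_i] and isolates the coefficient of the evaluation at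
    [v0]; freeness of [q] handles the others. *)
Lemma constraint_free (c : option 'I_k -> K) :
  (forall v, \sum_t C t v * c t = 0) -> forall t, c t = 0.
Proof.
move=> c0.
have sumo (g : option 'I_k -> K) : \sum_t g t = g None + \sum_i g (Some i).
  rewrite (bigD1 None) //=; congr (_ + _).
  rewrite (reindex_omap Some id) /=; last by case.
  by apply: eq_bigl => i; rewrite eqxx.
have cN : c None = 0.
  have : \sum_v \sum_t C t v * c t = 0 by rewrite big1.
  rewrite exchange_big /=; under eq_bigr do rewrite -mulr_suml.
  rewrite sumo /= [X in _ + X]big1 => [|i _]; last by rewrite q0 mul0r.
  by rewrite (bigD1 v0) //= eqxx big1 ?addr0 ?mul1r // => v /negPf->.
case=> [i|//]; have /freeP := freeq => /(_ (fun i => c (Some i))); apply.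
apply/ffunP=> v; rewrite ffunE sum_ffunE -[RHS](c0 v) sumo cN mulr0 add0r.
by apply: eq_bigr => {}i _; rewrite ffunE /= /qfun (tnth_nth 0) mulrC.
Qed.

(** For (a, c, f) in the kernel, a = -df and d^* a is a combination of constraints that f satisfies,
    so a is orthogonal to df, hence to itself. Then f is constant and zero at [v0], and c vanishes
    by [constraint_free]. *)
Lemma bordered0_neq0 : detF (B set0) != 0.
Proof.
apply: detF_neq0 => u u0.
pose a := \sum_e u (inl e) *: bs e.
pose f : Omega0 R kd G := [ffun v => u (inr (inr v))].
have a_coord e : dot1 x a (bs e) = u (inl e).
  rewrite linear_sumlz (bigD1 e) //= big1 => [|e' e'e].
    by rewrite linearZl_LR /= edge_basis_orthonormal eqxx mulr1 addr0.
  by rewrite linearZl_LR /= edge_basis_orthonormal (negPf e'e) mulr0.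
have adf : a + dmap R kd G f = 0.
  apply: omega1_eq0 => e; rewrite linearDl /= a_coord dot1_dmap_basis.
  rewrite -[RHS](u0 (inl e)) bordered_edge; congr (_ + _).
  by apply: eq_bigr => v _; rewrite ffunE.
have da v : dstar kd x a v = - \sum_t C t v * u (inr (inl t)).
  apply/eqP; rewrite -addr_eq0; apply/eqP; apply: etrans (u0 (inr (inr v))).
  rewrite bordered_vertex dstar_coord; congr (_ + _).
  by apply: eq_bigr => e _; rewrite a_coord.
have a0 : a = 0.
  suff aa : dot1 x a a = 0 by apply: (dot_eq0 (ip := dot1 x)) aa.
  have -> : dot1 x a a = - dot1 x a (dmap R kd G f).
    by apply/eqP; rewrite -addr_eq0 -linearDr adf linear0r.
  rewrite -dstarP /dot0 -sumrN.
  under eq_bigr do rewrite da mulNr opprK mulr_suml.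
  rewrite exchange_big big1 //= => t _.
  under eq_bigr do rewrite mulrAC mulrC.
  rewrite -mulr_sumr.
  rewrite (_ : \sum_v _ = cj (\sum_v cj (C t v) * u (inr (inr v)))).
    by rewrite -bordered_constraint u0 rmorph0 mulr0.
  by rewrite rmorph_sum; apply: eq_bigr => v _; rewrite rmorphM conjSK ffunE.
have df : dmap R kd G f = 0 by move: adf; rewrite a0 add0r.
have f0 v : u (inr (inr v)) = 0.
  have := dmap_eq0 v v0 df; rewrite !ffunE => ->.
  rewrite -[RHS](u0 (inr (inl None))) bordered_constraint /= (bigD1 v0) //= eqxx.
  by rewrite rmorph1 mul1r big1 ?addr0 // => w /negPf->; rewrite rmorph0 mul0r.
case=> [e|[t|//]]; first by rewrite -a_coord a0 linear0l.
move: t; apply: constraint_free => v; apply/eqP; rewrite -oppr_eq0 -da a0.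
by rewrite linear0 ffunE.
Qed.

Lemma dot0_constraint f i : dot0 f (tnth q i) = \sum_v cj (C (Some i) v) * f v.
Proof. by apply: eq_bigr => v _; rewrite mulrC. Qed.

(** A potential of the projection is normalised to vanish at [v0]; subtracting a constant preserves
    the other constraints, since each q_i has total 0. *)
Lemma orthproj_potential e : exists f,
  (forall t, \sum_v cj (C t v) * f v = 0) /\
  orthproj (dot1 x) (Hq q) (bs e) = dmap R kd G f.
Proof.
have /HqP[f fq ->] := mem_orthproj (dot1 x) (Hq q) (bs e).
exists (f - [ffun=> f v0]); split; last first.
  rewrite linearB /= (_ : dmap R kd G [ffun=> f v0] = 0) ?subr0 //.
  by apply: form_val_inj; apply/ffunP=> e'; rewrite lfunE dformE !ffunE subrr.
case=> [i|].
  under eq_bigr do rewrite !ffunE mulrBr.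
  rewrite sumrB -mulr_suml -rmorph_sum /= q0 rmorph0 mul0r subr0.
  by rewrite -dot0_constraint fq.
rewrite (bigD1 v0) //= big1 ?addr0 => [|v /negPf->]; first by rewrite !ffunE subrr mulr0.
by rewrite rmorph0 mul0r.
Qed.

(** The residual is orthogonal to every df with f orthogonal to the q_i, so its image under d^* lies
    in the double orthogonal of their span. The evaluation at [v0] gets coefficient 0. *)
Lemma orthproj_multiplier e : exists c : option 'I_k -> K,
  forall v, \sum_t C t v * c t = dstar kd x (bs e - orthproj (dot1 x) (Hq q) (bs e)) v.
Proof.
set w := bs e - _.
have wH : w \in orthov (dot1 x) (Hq q) by apply: sub_orthproj.
have dwq : dstar kd x w \in <<q>>%VS.
  apply: (orthovK (ip := @dot0 R kd G)) => f fq; rewrite [LHS]dstarP.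
  by move/mem_orthovP: wH; apply; apply: memv_img.
exists (fun t => if t is Some i then coord q i (dstar kd x w) else 0) => v.
rewrite {2}(coord_span dwq) sum_ffunE (bigD1 None) //= mulr0 add0r.
rewrite (reindex_omap Some id) /=; last by case.
apply: eq_big => [i|i _]; first by rewrite eqxx.
by rewrite ffunE /= /qfun (tnth_nth 0) mulrC.
Qed.

(** B_J is B_0 times [S]: for [e] in [J], the column of [e] in B_J is (0, 0, d^* e), and B_0 sends
    (Pi e, c, -g) to it, where Pi e = dg and d^* (e - Pi e) is the combination of the constraints
    with coefficients c. The other columns of B_J and B_0 agree. *)
Lemma bordered_det J : detF (B J) = detF (B set0) * proj_minor (dot1 x) bs (Hq q) J.
Proof.
have [g gP] := choice orthproj_potential; have [c cP] := choice orthproj_multiplier.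
pose Idx : finType := (pos_edge G + (option 'I_k + vertex G))%type.
pose S (i j : Idx) : K :=
  match j with
  | inl e => if e \in J then
      match i with
      | inl e' => proj_entry (dot1 x) bs (Hq q) e' e
      | inr (inl t) => c e t
      | inr (inr v) => - g e v
      end else (i == j)%:R
  | _ => (i == j)%:R
  end.
have sumI (A : Idx -> Idx -> K) i j : \sum_l A i l * (l == j)%:R = A i j.
  rewrite (bigD1 j) //= eqxx mulr1 big1 ?addr0 // => l lj.
  by rewrite (negPf lj) mulr0.
have -> : detF (B J) = detF (B set0) * detF S.
  rewrite detF_mul; apply: eq_detF => i j.
  have [[e [-> eJ]]|jJ] : (exists e, j = inl e /\ e \in J) \/
      (forall e, e \in J -> (inl e == j :> Idx) = false).
  - case: j => [e|j]; last by right.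
    have [eJ|eJ] := boolP (e \in J); [left; by exists e|right => e' e'J].
    by apply/eqP=> -[E]; rewrite -E e'J in eJ.
  - have [gC gd] := gP e.
    have co e' : proj_entry (dot1 x) bs (Hq q) e' e =
        \sum_v s e' * incidence K e' v * g e v.
      by rewrite -dot1_dmap_basis -gd.
    case: i => [e'|[t|v]].
    + rewrite bordered_edge /= eJ -[dot1 x _ _]/(proj_entry (dot1 x) bs (Hq q) e' e).
      rewrite co add0r -big_split /= big1 => [|v _].
        by case: ifPn => // e'J; case: eqP => // -[E]; rewrite E eJ in e'J.
      by rewrite mulrN subrr.
    + rewrite bordered_constraint /= eJ.
      by under eq_bigr do rewrite mulrN; rewrite sumrN gC oppr0.
    rewrite bordered_vertex /= eJ cP linearB /= !ffunE dstar_basisE dstar_coord.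
    by rewrite addrC subrK.
  have SE l : S l j = (l == j)%:R.
    case: j jJ => //= e jJ; case: ifP => // /jJ; by rewrite eqxx.
  under eq_bigr do rewrite SE.
  rewrite sumI; case: i => [e|i] //=; rewrite in_set0.
  by case: ifP => // /jJ ->.
(* Columns of [S] outside [J] are identity columns, so only the block of the projection on [J]
   counts. *)
congr (_ * _); rewrite (@detF_inj_col _ Idx _ (fun i : 'I_#|J| => inl (enum_val i))).
- rewrite detF_ord; congr (\det _); apply/matrixP => i j; rewrite !mxE /=.
  by rewrite enum_valP.
- by move=> i j [] /enum_val_inj.
move=> i [e|j] // nJ /=; case: ifP => // eJ; case/codomP: nJ.
by exists (enum_rank_in eJ e); rewrite enum_rankK_in.
Qed.

End ForestLaw.

(** * The law of the random forest *)

Lemma monomial_subgraph_of (R : realType) (G : ograph) (x : weights R G)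
    (F : {set pos_edge G}) :
  monomial x (subgraph_of F) = \prod_(e in F) x (val e).
Proof.
rewrite /monomial (eq_bigl (fun e => (e \in epos G) && (e \in subgraph_of F))).
  rewrite (big_sub_cond (epos G) (mem (subgraph_of F))); apply: eq_bigl => e.
  exact: val_mem_subgraph_of.
move=> e; rewrite !inE andbC; case: (e \in epos G) => //=.
have -> : (e \in @einv G @: subgraph_of F) = (e \in subgraph_of F).
  apply/imsetP/idP => [[f fF ->]|eF]; first by rewrite subgraph_ofV.
  by exists (einv e); rewrite ?subgraph_ofV // einvK.
by rewrite !inE orbb.
Qed.

Lemma forest_weight_ge0 (R : realType) (kd : scalar_kind) (G : ograph)
    (x : weights R G) (k : nat) (q : k.-tuple (Omega0 R kd G)) T F :
  0 <= forest_weight x q T F.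
Proof.
rewrite mulr_ge0 ?sqr_ge0 // prodr_ge0 // => e _.
exact/ltW/weight_gt0.
Qed.

Theorem theorem11p3 (R : realType) (kd : scalar_kind)
    (G : ograph) (x : weights R G) (k : nat) (q : k.-tuple (Omega0 R kd G))
    (T : {set pos_edge G} -> 'I_k -> {set vertex G}) :
  connected G ->
  (1 <= k)%N ->
  free q ->
  (forall i, tnth q i \in limg (dstar kd x)) ->
  tree_enum T ->
  is_law (forest_law x q T) /\
  determinantal (dot1 (kd := kd) x) (edge_basis kd x) (Hq q) (forest_law x q T).
Proof.
move=> conG k_gt0 freeq qim Tenum.
have q0 i : \sum_v qfun q i v = 0 by apply/(mem_im_dstar x).
(* On an empty vertex set all functions are zero, so no free family of length at least 1 exists. *)
have [v0 _|V0] := pickP (@predT (vertex G)); last first.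
  have /(free_not0 freeq)/eqP[] : tnth q (Ordinal k_gt0) \in q by apply: mem_tnth.
  by apply/ffunP=> v; have := V0 v.
pose cst := swap_det (Defs.scalar R kd) G.
pose B := bordered (conjS R kd) (qfun q) v0 (sqrt_weight kd x).
pose w := forest_weight x q T.
have detB (J : {set pos_edge G}) : detF (B J) =
    cst * ofR R kd (\sum_(X : {set pos_edge G} | (J \subset X) && (X \in forests G k)) w X).
  rewrite bordered_expand rmorph_sum mulr_sumr big_mkcondr.
  apply: eq_bigr => X _; case: ifPn => XF; last first.
    by apply: selected_not_forest XF => e; apply: cj_sqrt_weight.
  have [TI Tc] := Tenum X XF.
  have cj_s e : conjS R kd (sqrt_weight kd x e) = sqrt_weight kd x e.
    exact: cj_sqrt_weight.
  rewrite (selected_forest v0 cj_s q0 XF TI Tc) mulrC; congr (_ * _).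
  rewrite mulS_conj /w /forest_weight rmorphM; congr (_ * _).
  rewrite monomial_subgraph_of rmorph_prod -prodrXl; apply: eq_bigr => e _.
  by rewrite -rmorphXn sqr_sqrtr // ltW ?weight_gt0.
pose Z := \sum_(X in forests G k) w X.
have dZ : detF (B set0) = cst * ofR R kd Z.
  by rewrite detB; congr (_ * ofR R kd _); apply: eq_bigl => X; rewrite sub0set.
(* Nonsingularity of B_0 gives at once that the swap determinant and the total weight [Z] are
   nonzero. *)
have := bordered0_neq0 x v0 conG freeq q0; rewrite -/B dZ mulf_eq0 negb_or fmorph_eq0.
case/andP=> cst0 Z0.
have lawE (J : {set pos_edge G}) : \sum_(X : {set pos_edge G} | J \subset X) forest_law x q T X =
    (\sum_(X : {set pos_edge G} | (J \subset X) && (X \in forests G k)) w X) / Z.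
  by rewrite mulr_suml [RHS]big_mkcondr.
split.
  split=> [X|].
    rewrite /forest_law; case: ifP => // _.
    by rewrite divr_ge0 ?sumr_ge0 ?forest_weight_ge0 // => *; apply: forest_weight_ge0.
  (* The total mass is the inclusion probability of the empty set. *)
  have := lawE set0; rewrite (eq_bigl xpredT) => [->|X]; last by rewrite sub0set.
  by rewrite (eq_bigl (mem (forests G k))) ?divff // => X; rewrite sub0set.
move=> J; rewrite lawE fmorph_div.
have := bordered_det x v0 q0 J; rewrite -/B detB dZ -mulrA => /(mulfI cst0) ->.
by rewrite mulrAC divff ?fmorph_eq0 // mul1r.
Qed.
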